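(* Consider the zero-sum game with $E=\{1,2\}$, $\alpha=4/5$, $f(1)=g(1)=0$, $h(1)=2$, $f(2)=5$, $g(2)=3$, $h(2)=4$ and transition matrix $$\Pi=\begin{pmatrix}1/2&1/2\\0&1\end{pmatrix}.$$ The randomized stopping strategy pair $(p^{(1)},p^{(2)})$ given by $$p^{(1)}(1)=p^{(2)}(1)=1/2\quad\text{and}\quad p^{(1)}(2)=p^{(2)}(2)=1$$ is the unique global Markovian (randomized) equilibrium.
   Context: $X=(X_n)_{n\in\mathbb{N}_0}$ is the homogeneous Markov chain on $E$ with transition matrix $\Pi$; under $\mathbb{P}_x$ (expectation $\mathbb{E}_x$) it starts at $X_0=x\in E$. The probability space supports two sequences $(\xi^{(i)}_n)_{n\in\mathbb{N}_0}$, $i=1,2$, of iid uniform $(0,1)$ random variables, independent of $X$ and of each other. $\mathcal{T}_i$ is the set of ($\mathbb{N}_0\cup\{\infty\}$-valued) stopping times with respect to the filtration $\sigma(X_0,\dots,X_n,\xi^{(i)}_0,\dots,\xi^{(i)}_n)$, $n\in\mathbb{N}_0$. For $p^{(i)}:E\to[0,1]$, let $\tau^{p^{(i)}}=\inf\{n\in\mathbb{N}_0:\ p^{(i)}(X_n)\ge\xi^{(i)}_n\}$ ($\inf\emptyset=\infty$), the Markovian randomized stopping time of player $i$ identified with $p^{(i)}$. In the zero-sum game player 1 chooses $\tau_1\in\mathcal{T}_1$ to maximize, and player 2 chooses $\tau_2\in\mathcal{T}_2$ to minimize, $$J_1(x;\tau_1,\tau_2)=\mathbb{E}_x\big[\alpha^{\tau_1}f(X_{\tau_1})\mathbb{I}_{\{\tau_1<\tau_2\}}+\alpha^{\tau_2}g(X_{\tau_2})\mathbb{I}_{\{\tau_2<\tau_1\}}+\alpha^{\tau_1}h(X_{\tau_1})\mathbb{I}_{\{\tau_1=\tau_2<\infty\}}\big].$$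 A pair of functions $(p^{(1)},p^{(2)})$, $p^{(i)}:E\to[0,1]$, is a global Markovian (randomized) equilibrium if for all $x\in E$: $\sup_{\tau_1\in\mathcal{T}_1}J_1(x;\tau_1,\tau^{p^{(2)}})=J_1(x;\tau^{p^{(1)}},\tau^{p^{(2)}})=\inf_{\tau_2\in\mathcal{T}_2}J_1(x;\tau^{p^{(1)}},\tau_2)$. *)

(* Defs.v *)
From HB Require Import structures.
From mathcomp Require Import all_boot all_order all_algebra.
From mathcomp Require Import all_classical all_reals all_analysis.
Set Implicit Arguments.
Unset Strict Implicit.
Unset Printing Implicit Defensive.
Import Order.TTheory GRing.Theory Num.Theory.
Import numFieldNormedType.Exports.
Local Open Scope classical_set_scope.
Local Open Scope ring_scope.

(* The state space {1, 2} is encoded as ['I_2], whose elements are 0 and 1: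
   state [i] is the element [i - 1]. [on_states a b] maps 1 to [a], 2 to [b]. *)
Definition on_states (T : Type) (a b : T) : 'I_2 -> T :=
  fun e => if e == ord0 then a else b.

(* Random times are [Omega -> option nat], with [None] standing for infinity. *)

Definition time_le (t : option nat) (n : nat) : bool :=
  if t is Some k then (k <= n)%N else false.

Definition time_lt (s t : option nat) : bool :=
  match s, t with
  | Some m, Some n => (m < n)%N
  | Some _, None => true
  | None, _ => false
  end.

(* [inf {n | q n}], with [inf set0 = None] *)
Definition first_time (q : nat -> bool) : option nat :=
  if pselect (exists n, q n) is left h then Some (ex_minn h) else None.

(* The sigma-algebra generated by the variables [Z k], [k \in K], where the
   target space carries the sigma-algebra [G]. *)
Definition sigma_gen (Omega T : Type) (K : set nat) (Z : nat -> Omega -> T)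
    (G : set (set T)) : set (set Omega) :=
  <<s \bigcup_(k in K) preimage_set_system setT (Z k) G >>.

Definition independent_seq (R : realType) (d : measure_display)
    (Omega : measurableType d) (P : probability Omega R)
    (xi : nat -> Omega -> R) : Prop :=
  forall (s : seq nat) (B : nat -> set R), uniq s ->
    (forall k, measurable (B k)) ->
    P (\bigcap_(k in [set` s]) (xi k @^-1` B k)) =
    (\prod_(k <- s) P (xi k @^-1` B k))%E.

Definition iid_uniform01 (R : realType) (d : measure_display)
    (Omega : measurableType d) (P : probability Omega R)
    (xi : nat -> Omega -> R) : Prop :=
  [/\ forall n, measurable_fun setT (xi n),
      forall n (B : set R), measurable B ->
        P (xi n @^-1` B) = uniform_prob (@ltr01 R) B
    & independent_seq P xi].

(* [E] is countable and discrete: every subset is measurable, so measurability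
   of [X n] only has to be required on singletons. *)
Definition markov_chain (R : realType) (E : countType) (Pi : E -> E -> R)
    (d : measure_display) (Omega : measurableType d) (P : probability Omega R)
    (X : nat -> Omega -> E) (x : E) : Prop :=
  [/\ forall n e, measurable (X n @^-1` [set e]),
      P (X 0%N @^-1` [set x]) = 1%E
    & forall n (e : nat -> E),
        P [set w | forall k, (k <= n.+1)%N -> X k w = e k] =
        (P [set w | forall k, (k <= n)%N -> X k w = e k]
         * (Pi (e n) (e n.+1))%:E)%E].

(* The probabilistic setting of the game: under every [P x] the process [X] is
   the chain started at [x], and [X], [xi1], [xi2] are mutually independent. *)
Record randomized_chain (R : realType) (E : countType) (Pi : E -> E -> R)
    (d : measure_display) (Omega : measurableType d)
    (P : E -> probability Omega R) (X : nat -> Omega -> E)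
    (xi1 xi2 : nat -> Omega -> R) : Prop := RandomizedChain {
  rc_chain : forall x, markov_chain Pi (P x) X x;
  rc_xi1 : forall x, iid_uniform01 (P x) xi1;
  rc_xi2 : forall x, iid_uniform01 (P x) xi2;
  rc_indep : forall x (A B C : set Omega),
    sigma_gen setT X setT A ->
    sigma_gen setT xi1 measurable B ->
    sigma_gen setT xi2 measurable C ->
    P x (A `&` B `&` C) = (P x A * P x B * P x C)%E
}.

(* sigma(X_0, ..., X_n, xi_0, ..., xi_n) *)
Definition player_filtration (R : realType) (E : countType)
    (d : measure_display) (Omega : measurableType d)
    (X : nat -> Omega -> E) (xi : nat -> Omega -> R) (n : nat) :
    set (set Omega) :=
  <<s sigma_gen `I_n.+1 X setT `|` sigma_gen `I_n.+1 xi measurable >>.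

Definition stopping_times (R : realType) (E : countType)
    (d : measure_display) (Omega : measurableType d)
    (X : nat -> Omega -> E) (xi : nat -> Omega -> R) :
    set (Omega -> option nat) :=
  [set tau | forall n, player_filtration X xi n [set w | time_le (tau w) n]].

Definition markov_time (R : realType) (E : countType)
    (d : measure_display) (Omega : measurableType d)
    (X : nat -> Omega -> E) (xi : nat -> Omega -> R) (p : E -> R) :
    Omega -> option nat :=
  fun w => first_time (fun n => xi n w <= p (X n w)).

(* [alpha ^ tau * u (X_tau)]; the value for [tau = oo] is irrelevant, since
   the payoff only uses it on events where [tau] is finite. *)
Definition stopped_reward (R : realType) (E : countType)
    (d : measure_display) (Omega : measurableType d)
    (X : nat -> Omega -> E) (alpha : R) (u : E -> R)
    (tau : Omega -> option nat) (w : Omega) : R :=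
  if tau w is Some n then alpha ^+ n * u (X n w) else 0.

Definition payoff (R : realType) (E : countType)
    (d : measure_display) (Omega : measurableType d)
    (X : nat -> Omega -> E) (alpha : R) (f g h : E -> R)
    (tau1 tau2 : Omega -> option nat) (w : Omega) : R :=
  stopped_reward X alpha f tau1 w * (time_lt (tau1 w) (tau2 w))%:R
  + stopped_reward X alpha g tau2 w * (time_lt (tau2 w) (tau1 w))%:R
  + stopped_reward X alpha h tau1 w
    * ((tau1 w == tau2 w) && (tau1 w != None))%:R.

Definition J1 (R : realType) (E : countType)
    (d : measure_display) (Omega : measurableType d)
    (P : E -> probability Omega R) (X : nat -> Omega -> E)
    (alpha : R) (f g h : E -> R) (x : E)
    (tau1 tau2 : Omega -> option nat) : \bar R :=
  ('E_(P x)[payoff X alpha f g h tau1 tau2])%E.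

Definition global_markovian_equilibrium (R : realType) (E : countType)
    (d : measure_display) (Omega : measurableType d)
    (P : E -> probability Omega R) (X : nat -> Omega -> E)
    (xi1 xi2 : nat -> Omega -> R)
    (alpha : R) (f g h : E -> R) (p1 p2 : E -> R) : Prop :=
  [/\ forall e, 0 <= p1 e <= 1,
      forall e, 0 <= p2 e <= 1
    & forall x : E,
        let J := J1 P X alpha f g h x in
        let tau1 := markov_time X xi1 p1 in
        let tau2 := markov_time X xi2 p2 in
        ereal_sup [set J t1 tau2 | t1 in stopping_times X xi1] = J tau1 tau2
        /\
        J tau1 tau2 = ereal_inf [set J tau1 t2 | t2 in stopping_times X xi2]].

(* Main.v *)
Require Import Defs.
From HB Require Import structures.
From mathcomp Require Import all_boot all_order all_algebra.
From mathcomp Require Import all_classical all_reals all_analysis.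
From mathcomp Require Import measurable_realfun.
From mathcomp Require Import ring lra.
Set Implicit Arguments.
Unset Strict Implicit.
Unset Printing Implicit Defensive.
Import Order.TTheory GRing.Theory Num.Theory.
Import numFieldNormedType.Exports.
Local Open Scope classical_set_scope.
Local Open Scope ring_scope.

(** Against a Markovian opponent, a player faces an optimal stopping problem,
    and the two strategies form an equilibrium exactly when no one-shot
    deviation pays ([equilibriumP]): with W the value of the pair, player 1 gets
    at most W by stopping now and by waiting one step, and player 2 pays at
    least W by either.

    The bridge from measure theory to these inequalities is a supermartingale
    argument ([mean_payoff_le]). Buy out a game still running at time n at the
    price W n of its current state. From n to n + 1 the mean of this payoff
    changes by an explicit amount, because the draw of the opponent at time n
    is independent of the past ([draw_indep_history]) and the chain keeps its
    transition law given both randomizations ([chain_step_history]). If W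
    dominates both gains the mean decreases, and discounting makes it converge
    to the mean payoff. This bounds all stopping times of player 1; for
    randomized times one gets equality, by negating the rewards
    ([J1_randomized]); and player 2 is handled by exchanging the players
    ([payoff_swap]).

    What remains is arithmetic. At state 2, W is at least 5 - q by stopping
    and at most 3 + p by stopping of player 2, which forces p = q = 1 and the
    value 4. At state 1, stopping gives 2 q <= W <= 2 p, and waiting gives
    (1 - q) c <= W <= (1 - p) c with c = (2 / 5) (W + 4) > 0, whence p = q, and
    then p = 1 / 2 and W = 1. Conversely these values make both players
    indifferent at state 1. *)

(** * Sigma-algebras of events and measures on pi-systems *)

Section SigmaAlgebraEvents.
Context {T : Type} {F : set (set T)}.
Hypothesis sF : sigma_algebra setT F.

Lemma sigma_algebra_not (b : T -> bool) :
  F [set w | b w] -> F [set w | ~~ b w].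
Proof.
case: sF => _ FC _ Fb; rewrite (_ : [set w | ~~ b w] = setT `\` [set w | b w]).
  exact: FC.
by apply/seteqP; split => w /=; [move=> /negP ? | move=> [_ /negP]].
Qed.

Lemma sigma_algebra_exists (I : countType) (b : I -> T -> bool) :
  (forall i, F [set w | b i w]) -> F [set w | exists i, b i w].
Proof.
case: sF => F0 _ FU Fb.
rewrite (_ : [set w | _] = \bigcup_n (if unpickle n is Some i
    then [set w | b i w] else set0)).
  by apply: FU => n; case: unpickle.
apply/seteqP; split => w /=.
  by move=> [i bi]; exists (pickle i) => //; rewrite pickleK.
by move=> [n _]; case: (unpickle n) => // i /= bi; exists i.
Qed.

Lemma sigma_algebra_or (b c : T -> bool) :
  F [set w | b w] -> F [set w | c w] -> F [set w | b w || c w].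
Proof.
move=> Fb Fc; have := @sigma_algebra_exists bool (fun i w => if i then b w else c w).
rewrite (_ : [set w | exists _, _] = [set w | b w || c w]); first by apply; case.
apply/seteqP; split => w /=; first by move=> [[] ->] //; rewrite orbT.
by move=> /orP[? | ?]; [exists true | exists false].
Qed.

Lemma sigma_algebra_and (b c : T -> bool) :
  F [set w | b w] -> F [set w | c w] -> F [set w | b w && c w].
Proof.
move=> Fb Fc; under eq_fun do rewrite -[_ && _]negbK negb_and.
by apply/sigma_algebra_not/sigma_algebra_or; exact: sigma_algebra_not.
Qed.

Lemma sigma_algebra_true : F [set w | true].
Proof.
case: sF => F0 FC _; have := FC _ F0; rewrite setD0; congr F.
by apply/seteqP; split.
Qed.

Lemma sigma_algebra_all (I : Type) (s : seq I) (b : I -> T -> bool) :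
  (forall i, F [set w | b i w]) -> F [set w | all (b ^~ w) s].
Proof.
move=> Fb; elim: s => [|i s IHs] /=; first exact: sigma_algebra_true.
exact: sigma_algebra_and.
Qed.

Lemma sigma_algebra_comp (I : countType) (Z : T -> I) (b : I -> T -> bool) :
    (forall i, F [set w | Z w == i]) -> (forall i, F [set w | b i w]) ->
  F [set w | b (Z w) w].
Proof.
move=> FZ Fb; rewrite (_ : [set w | _] = [set w | exists i, (Z w == i) && b i w]).
  by apply: (sigma_algebra_exists (b := fun i w => (Z w == i) && b i w)) => i;
    exact: (sigma_algebra_and (b := fun w => Z w == i)).
apply/seteqP; split => w /=; first by move=> bw; exists (Z w); rewrite eqxx.
by move=> [i /andP[/eqP ->]].
Qed.

Lemma sigma_algebra_setI (A B : set T) : F A -> F B -> F (A `&` B).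
Proof.
move=> FA FB; have E C : [set w | `[< C w >]] = C.
  by apply/seteqP; split => w /= /asboolP.
have := @sigma_algebra_and (fun w => `[< A w >]) (fun w => `[< B w >]).
rewrite !E => /(_ FA FB); congr F.
by apply/seteqP; split => w /=; [move=> /andP[/asboolP ? /asboolP]
  | move=> [? ?]; apply/andP; split; apply/asboolP].
Qed.

End SigmaAlgebraEvents.

Section PiLambda.
Context {R : realType} {d : measure_display} {Omega : measurableType d}.
Variable P : probability Omega R.

(** Both sides are finite measures in D, so agreement on a pi-system extends to
    the sigma-algebra it generates. With K the whole space this propagates
    independence from Z; with Z inside K it propagates the statement that Z
    has conditional probability c given K. *)
Lemma pi_lambda_factor (G : set (set Omega)) (Z K : set Omega) (c : R) :
    setI_closed G -> G setT -> G `<=` measurable ->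
    measurable Z -> measurable K -> 0 <= c ->
    (forall D, G D -> P (D `&` Z) = c%:E * P (D `&` K))%E ->
  forall D, <<s G >> D -> (P (D `&` Z) = c%:E * P (D `&` K))%E.
Proof.
move=> GI GT Gm mZ mK c0 PG D GD.
pose m1 := mrestr P mZ; pose m2 := mscale (NngNum c0) (mrestr P mK).
apply: (g_sigma_algebra_measure_unique G Gm (fun=> setT) _ _ m1 m2) => //.
- by apply/seteqP; split => // w _; exists 0%N.
- move=> _; rewrite /m1 /= /mrestr setTI.
  by rewrite (le_lt_trans (probability_le1 P mZ)) ?ltry.
Qed.

End PiLambda.

(** * Iid uniform randomization *)

Section GeneratedBySequence.
Context {Omega T : Type}.
Implicit Types (K : set nat) (Z : nat -> Omega -> T) (G : set (set T)).

Lemma sigma_gen_sigma_algebra K Z G : sigma_algebra setT (sigma_gen K Z G).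
Proof. exact: smallest_sigma_algebra. Qed.

Lemma sigma_gen_preimage K Z G k (B : set T) :
  K k -> G B -> sigma_gen K Z G (Z k @^-1` B).
Proof.
move=> Kk GB; apply: sub_sigma_algebra; exists k => //; exists B => //.
by rewrite setTI.
Qed.

Lemma sigma_gen_sub K Z G (F : set (set Omega)) : sigma_algebra setT F ->
  (forall k B, K k -> G B -> F (Z k @^-1` B)) -> sigma_gen K Z G `<=` F.
Proof.
move=> sF FG; apply: smallest_sub => // A [k Kk [B GB <-]].
by rewrite setTI; exact: FG.
Qed.

Lemma sigma_gen_monotone K K' Z G : K `<=` K' ->
  sigma_gen K Z G `<=` sigma_gen K' Z G.
Proof.
move=> KK'; apply: sigma_gen_sub; first exact: sigma_gen_sigma_algebra.
by move=> k B /KK' Kk; exact: sigma_gen_preimage.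
Qed.

End GeneratedBySequence.

Lemma measurable_sigma_algebra (d : measure_display) (T : measurableType d) :
  sigma_algebra setT (@measurable d T).
Proof.
split=> //; last exact: bigcupT_measurable.
by move=> A mA; exact: measurableD.
Qed.

Lemma measurable_ler (R : realType) (c : R) : measurable [set y : R | y <= c].
Proof.
rewrite (_ : [set y | _] = `]-oo, c]%classic); first exact: measurable_itv.
by apply/seteqP; split=> y /=; rewrite in_itv.
Qed.

Section Randomization.
Context {R : realType} {d : measure_display} {Omega : measurableType d}.
Variable P : probability Omega R.
Variable eta : nat -> Omega -> R.
Hypothesis eta_iid : iid_uniform01 P eta.

(** This is where the randomization level of a strategy becomes the actual
    stopping probability. *)
Lemma uniform_prob_le (c : R) : 0 <= c <= 1 ->
  uniform_prob (@ltr01 R) [set y | y <= c] = c%:E.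
Proof.
move=> /andP[c0 c1]; rewrite /uniform_prob integral_uniform_pdf.
rewrite (_ : _ `&` _ = `[0, c]%classic); last first.
  apply/seteqP; split => y /=; rewrite !in_itv /=; first by move=> [-> /andP[->]].
  by move=> /andP[y0 yc]; rewrite y0 (le_trans yc c1).
rewrite (eq_integral (fun=> 1%E)); last first.
  move=> y; rewrite inE /= in_itv /= => /andP[y0 yc].
  by rewrite /uniform_pdf y0 (le_trans yc c1) subr0 invr1.
rewrite integral_cst //= mul1e lebesgue_measure_itv /= lte_fin oppr0 adde0.
by case: ltP => // c0'; congr EFin; apply/eqP; rewrite eq_le c0 c0'.
Qed.

Lemma sigma_gen_real_measurable K : sigma_gen K eta measurable `<=` measurable.
Proof.
apply: sigma_gen_sub; first exact: measurable_sigma_algebra.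
case: eta_iid => meta _ _ k B _ mB.
by rewrite -[X in measurable X]setTI; exact: meta.
Qed.

(** The past of an iid uniform sequence does not affect the next draw: on
    finite intersections this is the product rule, and these form a pi-system
    generating the past. *)
Lemma uniform_draw_indep n (c : R) C : 0 <= c <= 1 ->
  sigma_gen `I_n eta measurable C ->
  (P (C `&` [set w | (eta n w <= c)%R]) = c%:E * P C)%E.
Proof.
move=> c01; case: (eta_iid) => meta unif indep.
pose cyl (s : seq nat) (B : nat -> set R) :=
  \bigcap_(k in [set` s]) (eta k @^-1` B k).
pose G := [set D | exists2 B, (forall k, measurable (B k)) & D = cyl (iota 0 n) B].
have mcyl s B : (forall k, measurable (B k)) -> measurable (cyl s B).
  move=> mB; apply: fin_bigcap_measurable => [|k _]; first exact: finite_seq.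
  by rewrite -[X in measurable X]setTI; exact: meta.
have mle := measurable_ler c.
have GI : setI_closed G.
  move=> _ _ [B mB ->] [B' mB' ->]; exists (fun k => B k `&` B' k).
    by move=> k; exact: measurableI.
  by rewrite /cyl bigcapI.
have GT : G setT.
  by exists (fun=> setT) => //; apply/seteqP; split.
have Gm : G `<=` measurable by move=> _ [B mB ->]; exact: mcyl.
have PG D : G D -> (P (D `&` [set w | (eta n w <= c)%R]) = c%:E * P (D `&` setT))%E.
  move=> [B mB ->]; rewrite setIT.
  pose B' k := if k == n then [set y : R | y <= c] else B k.
  have BB' k : k \in iota 0 n -> B' k = B k.
    by rewrite mem_iota add0n /B' => /andP[_]; case: ltngtP.
  have -> : cyl (iota 0 n) B `&` [set w | eta n w <= c] = cyl (n :: iota 0 n) B'.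
    apply/seteqP; split => w /=.
      move=> [Bw cw] k /=; rewrite inE => /predU1P[-> | ks].
        by rewrite /B' eqxx.
      by rewrite BB' //; exact: Bw.
    move=> Bw; split; last by have := Bw n; rewrite /B' eqxx /= mem_head; exact.
    by move=> k /= ks; rewrite -BB' //; apply: Bw; rewrite /= inE ks orbT.
  have us : uniq (n :: iota 0 n) by rewrite /= iota_uniq mem_iota add0n ltnn.
  rewrite indep //; last by move=> k; rewrite /B'; case: ifP.
  rewrite big_cons {1}/B' eqxx unif // uniform_prob_le //; congr (_ * _)%E.
  rewrite indep ?iota_uniq //; apply: eq_big_seq => k ks.
  by rewrite BB'.
move=> CG; rewrite -[C in RHS]setIT.
apply: (pi_lambda_factor GI GT Gm _ _ _ PG) => //.
- by have := meta n measurableT _ mle; rewrite setTI.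
- by case/andP: c01.
- apply: (sigma_gen_sub _ _ CG); first exact: smallest_sigma_algebra.
  move=> k B kn mB; apply: sub_sigma_algebra.
  exists (fun j => if j == k then B else setT).
    by move=> j; case: ifP.
  apply/seteqP; split => w /=.
    by move=> Bw j _ /=; case: eqP => // ->.
  move=> /(_ k) /=; rewrite mem_iota add0n eqxx; exact.
Qed.

End Randomization.

(** * Independence from the past and the Markov property *)

Section History.
Context {R : realType} {E : finType} {Pi : E -> E -> R} {d : measure_display}.
Context {Omega : measurableType d} {P : E -> probability Omega R}.
Context {X : nat -> Omega -> E} {xi eta : nat -> Omega -> R}.
Hypothesis rc : randomized_chain Pi P X xi eta.
Variable x : E.
Implicit Types (K Kx Ki Kj : set nat).


(** Rectangles form a pi-system on which the mutual independence of the chain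
    and the two randomizations splits probabilities into products. *)
Definition history_rectangles Kx Ki Kj : set (set Omega) :=
  [set D | exists A B C, [/\ sigma_gen Kx X setT A,
    sigma_gen Ki xi measurable B, sigma_gen Kj eta measurable C
    & D = A `&` B `&` C]].

(** The information in the chain at the times in Kx, the own randomization at
    the times in Ki and the randomization of the opponent at the times in Kj.
    Three separate time sets are needed: a new draw is compared with the past
    of its own sequence but with the whole of the two others. *)
Definition history Kx Ki Kj := <<s history_rectangles Kx Ki Kj >>.

Lemma sigma_gen_chain_measurable K : sigma_gen K X setT `<=` measurable.
Proof.
apply: sigma_gen_sub; first exact: measurable_sigma_algebra.
move=> k B _ _.
rewrite (_ : X k @^-1` B = \bigcup_(e in B) (X k @^-1` [set e])); last first.
  by apply/seteqP; split => w /= => [Bw | [e Be ->]] //; exists (X k w).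
apply: fin_bigcup_measurable; first exact: finite_finset.
move=> e _; case: (rc_chain rc x) => mX _ _; exact: mX.
Qed.

Lemma history_rectangles_setI Kx Ki Kj :
  setI_closed (history_rectangles Kx Ki Kj).
Proof.
move=> _ _ [A [B [C [hA hB hC ->]]]] [A' [B' [C' [hA' hB' hC' ->]]]].
exists (A `&` A'), (B `&` B'), (C `&` C'); split.
- exact: (sigma_algebra_setI (sigma_gen_sigma_algebra _ _ _)).
- exact: (sigma_algebra_setI (sigma_gen_sigma_algebra _ _ _)).
- exact: (sigma_algebra_setI (sigma_gen_sigma_algebra _ _ _)).
- by rewrite (setIACA A) setIACA.
Qed.

Lemma sigma_gen_setT (T : Type) K (Z : nat -> Omega -> T) G :
  sigma_gen K Z G setT.
Proof.
have := sigma_algebra_true (sigma_gen_sigma_algebra K Z G).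
by congr (sigma_gen K Z G); apply/seteqP; split.
Qed.

Lemma history_rectangles_setT Kx Ki Kj : history_rectangles Kx Ki Kj setT.
Proof.
by exists setT, setT, setT; rewrite !setIT; split => //; exact: sigma_gen_setT.
Qed.

Lemma history_rectangles_measurable Kx Ki Kj :
  history_rectangles Kx Ki Kj `<=` measurable.
Proof.
move=> _ [A [B [C [hA hB hC ->]]]].
apply: measurableI; first apply: measurableI.
- exact: sigma_gen_chain_measurable hA.
- exact: sigma_gen_real_measurable (rc_xi1 rc x) _ _ hB.
- exact: sigma_gen_real_measurable (rc_xi2 rc x) _ _ hC.
Qed.

Lemma history_sigma_algebra Kx Ki Kj : sigma_algebra setT (history Kx Ki Kj).
Proof. exact: smallest_sigma_algebra. Qed.

Lemma history_measurable Kx Ki Kj : history Kx Ki Kj `<=` measurable.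
Proof.
apply: smallest_sub; first exact: measurable_sigma_algebra.
exact: history_rectangles_measurable.
Qed.

Lemma history_chain Kx Ki Kj : sigma_gen Kx X setT `<=` history Kx Ki Kj.
Proof.
move=> A hA; apply: sub_sigma_algebra; exists A, setT, setT.
by rewrite !setIT; split => //; exact: sigma_gen_setT.
Qed.

Lemma history_own Kx Ki Kj : sigma_gen Ki xi measurable `<=` history Kx Ki Kj.
Proof.
move=> B hB; apply: sub_sigma_algebra; exists setT, B, setT.
by rewrite setTI setIT; split => //; exact: sigma_gen_setT.
Qed.

Lemma history_opponent Kx Ki Kj :
  sigma_gen Kj eta measurable `<=` history Kx Ki Kj.
Proof.
move=> C hC; apply: sub_sigma_algebra; exists setT, setT, C.
by rewrite !setTI; split => //; exact: sigma_gen_setT.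
Qed.

Lemma history_state Kx Ki Kj k e : Kx k ->
  history Kx Ki Kj [set w | X k w == e].
Proof.
move=> Kk; apply: history_chain.
rewrite (_ : [set w | _] = X k @^-1` [set e]); first exact: sigma_gen_preimage.
by apply/seteqP; split => w /= /eqP.
Qed.

Lemma history_opponent_draw Kx Ki Kj k (p : E -> R) : Kx k -> Kj k ->
  history Kx Ki Kj [set w | eta k w <= p (X k w)].
Proof.
move=> Kk Kk'.
apply: (sigma_algebra_comp (history_sigma_algebra Kx Ki Kj)
  (b := fun e w => eta k w <= p e)) => e; first exact: history_state.
apply: history_opponent.
apply: (@sigma_gen_preimage _ _ _ eta _ k [set y | y <= p e]) => //.
exact: measurable_ler.
Qed.

Lemma history_filtration Kx Ki Kj n : `I_n.+1 `<=` Kx -> `I_n.+1 `<=` Ki ->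
  player_filtration X xi n `<=` history Kx Ki Kj.
Proof.
move=> nx ni; apply: smallest_sub; first exact: history_sigma_algebra.
move=> A [] hA.
- by apply: history_chain; exact: sigma_gen_monotone hA.
- by apply: history_own; exact: sigma_gen_monotone hA.
Qed.

(** On a rectangle the new draw meets only the factor of its own sequence, and
    there it is independent of the past. *)
Lemma draw_indep_history n (c : R) D : 0 <= c <= 1 ->
  history setT setT `I_n D ->
  (P x (D `&` [set w | (eta n w <= c)%R]) = c%:E * P x D)%E.
Proof.
move=> c01; rewrite -[D in RHS]setIT => hD.
apply: (pi_lambda_factor (@history_rectangles_setI _ _ _)
  (history_rectangles_setT _ _ _) (@history_rectangles_measurable _ _ _)
  _ _ _ _ hD) => //.
- have [meta _ _] := rc_xi2 rc x.
  by have := meta n measurableT _ (measurable_ler c); rewrite setTI.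
- by case/andP: c01.
move=> _ [A [B [C [hA hB hC ->]]]]; rewrite setIT -setIA.
have hC' : sigma_gen setT eta measurable C by exact: sigma_gen_monotone hC.
rewrite (rc_indep rc) //; last first.
  apply: (sigma_algebra_setI (sigma_gen_sigma_algebra _ _ _)) => //.
  apply: (@sigma_gen_preimage _ _ _ eta _ n [set y | y <= c]) => //.
  exact: measurable_ler.
rewrite (rc_indep rc) // (uniform_draw_indep (rc_xi2 rc x) c01 hC).
by rewrite muleCA.
Qed.

Definition path_event n (p : {ffun 'I_n.+1 -> E}) :=
  [set w | forall k : 'I_n.+1, X k w = p k].

Lemma measurable_path_event n p : measurable (@path_event n p).
Proof.
rewrite (_ : path_event p = \bigcap_(k in [set: 'I_n.+1]) (X k @^-1` [set p k])).
  apply: fin_bigcap_measurable => [|k _]; first exact: finite_finset.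
  by have [mX _ _] := rc_chain rc x; exact: mX.
by apply/seteqP; split => w /= => [h k _|h k]; exact: h.
Qed.

Lemma path_event_step n p e :
  (P x (path_event p `&` X n.+1 @^-1` [set e]) =
   (Pi (p ord_max) e)%:E * P x (@path_event n p))%E.
Proof.
have [mX _ step] := rc_chain rc x.
pose s k := if (k <= n)%N then p (inord k) else e.
have sE (k : 'I_n.+1) : s k = p k by rewrite /s -ltnS ltn_ord inord_val.
have pathE : [set w | forall k, (k <= n)%N -> X k w = s k] = path_event p.
  apply/seteqP; split => w /= h k; first by rewrite h -?sE // -ltnS ltn_ord.
  by move=> kn; have := h (inord k); rewrite -sE inordK.
have := step n s; rewrite pathE muleC.
rewrite (_ : s n = p ord_max) ?(sE ord_max) // {2}/s ltnn => <-.
congr (P x _); apply/seteqP; split => w /=.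
  move=> [h hn] k; rewrite leq_eqVlt => /predU1P[-> | ].
    by rewrite hn /s ltnn.
  rewrite ltnS; move: k.
  by rewrite -[forall k, _]/([set w | forall k, (k <= n)%N -> X k w = s k] w) pathE.
move=> h; split; last by rewrite h // /s ltnn.
by move=> k; rewrite -sE h // ltnW // ltn_ord.
Qed.

(** The sets that do not separate w from w' form a sigma-algebra, which
    contains the generators as soon as the two paths agree up to time n. *)
Lemma path_determined n A w w' : sigma_gen `I_n.+1 X setT A ->
  (forall k, (k <= n)%N -> X k w = X k w') -> A w -> A w'.
Proof.
move=> hA Xww'.
suff : A w <-> A w' by case.
pose F := [set B : set Omega | B w <-> B w'].
have sF : sigma_algebra setT F.
  split => //=.
  - by move=> B [h1 h2]; split => -[_ nB]; split => // ?; apply: nB; auto.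
  - by move=> B hB; split => -[i _ Bi]; exists i => //; apply/hB.
apply: (sigma_gen_sub sF _ hA) => k B /= kn _; rewrite /F /= Xww' //.
Qed.

(** An event of the chain up to time n is a finite disjoint union of path
    events, on each of which the transition rule is the Markov property. *)
Lemma chain_step n e e' A : sigma_gen `I_n.+1 X setT A ->
  (P x (A `&` [set w | X n w = e /\ X n.+1 w = e']) =
   (Pi e e')%:E * P x (A `&` X n @^-1` [set e]))%E.
Proof.
move=> hA; have [mX _ _] := rc_chain rc x.
pose D := [set p : {ffun 'I_n.+1 -> E} | p ord_max = e /\
  exists2 w, A w & forall k : 'I_n.+1, X k w = p k].
have AE : A `&` X n @^-1` [set e] = \bigcup_(p in D) path_event p.
  apply/seteqP; split => w /=.
    move=> [Aw Xe]; exists [ffun k : 'I_n.+1 => X k w] => /=.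
      by split; [rewrite ffunE | exists w => // k; rewrite ffunE].
    by move=> k; rewrite ffunE.
  move=> [p [pe [w' Aw' pw']] pw]; split; last by have := pw ord_max; rewrite pe.
  apply: (path_determined hA _ Aw') => k; rewrite -ltnS => kn.
  by have := pw (Ordinal kn); have := pw' (Ordinal kn) => /= -> ->.
have AE' : A `&` [set w | X n w = e /\ X n.+1 w = e'] =
    \bigcup_(p in D) (path_event p `&` X n.+1 @^-1` [set e']).
  by rewrite -setI_bigcupl -AE -setIA.
have fD : finite_set D by exact: finite_finset.
have dis : trivIset D (@path_event n).
  move=> p q _ _ [w [pw qw]]; apply/ffunP => k.
  by rewrite -pw -qw.
have mF p : measurable (path_event p `&` X n.+1 @^-1` [set e']).
  by apply: measurableI; [exact: measurable_path_event | exact: mX].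
have PE : P x (A `&` X n @^-1` [set e]) = (\sum_(p \in D) P x (path_event p))%E.
  rewrite AE; apply: measure_fin_bigcup => // p _.
  exact: measurable_path_event.
rewrite PE AE'.
transitivity (\sum_(p \in D) P x (path_event p `&` X n.+1 @^-1` [set e']))%E.
  by apply: measure_fin_bigcup => //; exact: trivIset_setIr.
rewrite ge0_mule_fsumr => [|p]; last exact: measure_ge0.
by apply: eq_fsbigr => p; rewrite inE => -[pe _]; rewrite path_event_step pe.
Qed.

(** Randomization does not disturb the transitions: on a rectangle the step
    only meets the factor of the chain. *)
Lemma chain_step_history n e e' D : 0 <= Pi e e' ->
  history `I_n.+1 setT setT D ->
  (P x (D `&` [set w | X n w = e /\ X n.+1 w = e']) =
   (Pi e e')%:E * P x (D `&` X n @^-1` [set e]))%E.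
Proof.
move=> Pi0 hD; have [mX _ _] := rc_chain rc x.
have hX k s : sigma_gen setT X setT (X k @^-1` [set s]).
  exact: sigma_gen_preimage.
have stepE : [set w | X n w = e /\ X n.+1 w = e'] =
   X n @^-1` [set e] `&` X n.+1 @^-1` [set e'] by [].
apply: (pi_lambda_factor (@history_rectangles_setI _ _ _)
  (history_rectangles_setT _ _ _) (@history_rectangles_measurable _ _ _)
  _ _ _ _ hD) => //.
  by rewrite stepE; apply: measurableI; exact: mX.
move=> _ [A [B [C [hA hB hC ->]]]].
have hA' : sigma_gen setT X setT A by exact: sigma_gen_monotone hA.
have swap Z : A `&` B `&` C `&` Z = A `&` Z `&` B `&` C.
  by rewrite (setIAC _ C) (setIAC _ B).
rewrite !swap !(rc_indep rc) //.
- by rewrite chain_step // !muleA.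
- exact: (sigma_algebra_setI (sigma_gen_sigma_algebra _ _ _)).
- rewrite stepE; apply: (sigma_algebra_setI (sigma_gen_sigma_algebra _ _ _)) => //.
  exact: (sigma_algebra_setI (sigma_gen_sigma_algebra _ _ _)).
Qed.

End History.

(** * Means of bounded random variables *)

Section BoundedExpectation.
Context {R : realType} {d : measure_display} {Omega : measurableType d}.
Variable P : probability Omega R.
Implicit Types (u v : Omega -> R) (b e : Omega -> bool).

Definition bounded_rv u :=
  measurable_fun setT u /\ exists M : R, forall w, `|u w| <= M.

(** Bounded variables have finite means, so the bookkeeping of finite sums can
    stay inside the ordered field. *)
Definition mean u : R := \int[P]_w u w.

Definition prob b : R := fine (P [set w | b w]).

Lemma bounded_rv_integrable u : bounded_rv u -> P.-integrable setT (EFin \o u).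
Proof.
move=> [mu [M uM]]; apply: measurable_bounded_integrable => //.
  by rewrite (le_lt_trans (probability_le1 P measurableT)) ?ltry.
exists M; split; first exact: num_real.
by move=> r /ltW Mr w _; exact: le_trans (uM w) Mr.
Qed.

Lemma expectation_mean u : bounded_rv u -> ('E_P[u] = (mean u)%:E)%E.
Proof.
move=> /bounded_rv_integrable iu.
by rewrite /mean /Rintegral fineK ?unlock // integrable_fin_num.
Qed.

Lemma bounded_rvD u v : bounded_rv u -> bounded_rv v ->
  bounded_rv (fun w => u w + v w).
Proof.
move=> [mu [M uM]] [mv [N vN]]; split; first exact: measurable_funD.
by exists (M + N) => w; rewrite (le_trans (ler_normD _ _)) // lerD.
Qed.

Lemma bounded_rvZ (c : R) u : bounded_rv u -> bounded_rv (fun w => c * u w).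
Proof.
move=> [mu [M uM]]; split.
  by apply: measurable_funM => //; exact: measurable_cst.
by exists (`|c| * M) => w; rewrite normrM ler_wpM2l.
Qed.

Lemma indicator_bool b w : \1_[set w | b w] w = (b w)%:R :> R.
Proof. by rewrite indicE; congr ((nat_of_bool _)%:R);
  apply/idP/idP; rewrite inE. Qed.

Lemma bounded_rv_indicator b : measurable [set w | b w] ->
  bounded_rv (fun w => (b w)%:R).
Proof.
move=> mb; split; last by exists 1 => w; case: (b w); rewrite ?normr0 ?normr1.
rewrite (_ : (fun _ => _) = \1_[set w | b w]) //.
by apply/funext => w; rewrite indicator_bool.
Qed.

Lemma bounded_rv_sum (I : Type) (s : seq I) (u_ : I -> Omega -> R) :
  (forall i, bounded_rv (u_ i)) -> bounded_rv (fun w => \sum_(i <- s) u_ i w).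
Proof.
move=> bu; elim: s => [|i s IHs].
  under eq_fun do rewrite big_nil.
  by split; [exact: measurable_cst | exists 0 => w; rewrite normr0].
by under eq_fun do rewrite big_cons; exact: bounded_rvD.
Qed.

Lemma meanD u v : bounded_rv u -> bounded_rv v ->
  mean (fun w => u w + v w) = mean u + mean v.
Proof.
move=> /bounded_rv_integrable iu /bounded_rv_integrable iv.
by rewrite /mean RintegralD.
Qed.

Lemma meanZ (c : R) u : bounded_rv u -> mean (fun w => c * u w) = c * mean u.
Proof. by move=> /bounded_rv_integrable iu; rewrite /mean RintegralZl. Qed.

Lemma mean_cst (c : R) : mean (fun=> c) = c.
Proof.
by rewrite /mean /Rintegral; have := expectation_cst P c; rewrite unlock => ->.
Qed.

Lemma mean_indicator b : measurable [set w | b w] ->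
  mean (fun w => (b w)%:R) = prob b.
Proof.
move=> mb; rewrite /mean /Rintegral /prob; congr fine.
rewrite -[in RHS](setIT [set w | b w]) -integral_indic //.
by apply: eq_integral => w _; rewrite indicator_bool.
Qed.

Lemma mean_sum (I : Type) (s : seq I) (u_ : I -> Omega -> R) :
  (forall i, bounded_rv (u_ i)) ->
  mean (fun w => \sum_(i <- s) u_ i w) = \sum_(i <- s) mean (u_ i).
Proof.
move=> bu; elim: s => [|i s IHs].
  by under eq_fun do rewrite big_nil; rewrite big_nil mean_cst.
under eq_fun do rewrite big_cons.
by rewrite big_cons meanD ?IHs //; exact: bounded_rv_sum.
Qed.

Lemma mean_le u v : bounded_rv u -> bounded_rv v -> (forall w, u w <= v w) ->
  mean u <= mean v.
Proof.
move=> /bounded_rv_integrable iu /bounded_rv_integrable iv uv.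
by apply: le_Rintegral => // w _.
Qed.

Lemma prob_ge0 b : 0 <= prob b.
Proof. exact: fine_ge0. Qed.

Lemma prob_split b e : measurable [set w | b w] -> measurable [set w | e w] ->
  prob (fun w => b w && ~~ e w) = prob b - prob (fun w => b w && e w).
Proof.
move=> mb me; have sm := measurable_sigma_algebra Omega.
have mbe := sigma_algebra_and sm mb me.
have mbne := sigma_algebra_and sm mb (sigma_algebra_not sm me).
rewrite -!mean_indicator // -mulN1r -meanZ; last exact: bounded_rv_indicator.
rewrite -meanD; [ | exact: bounded_rv_indicator | ]; last first.
  by apply: bounded_rvZ; exact: bounded_rv_indicator.
congr mean; apply/funext => w.
by case: (b w) (e w) => [] [] /=; rewrite ?mulN1r ?subrr ?subr0.
Qed.

End BoundedExpectation.

(** * Stopping against a Markovian opponent *)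

Lemma time_lt_S (t : option nat) n :
  time_lt t (Some n.+1) = time_lt t (Some n) || (t == Some n).
Proof.
case: t => [k|] //=; rewrite ltnS leq_eqVlt orbC.
by congr (_ || _); apply/eqP/eqP => [-> | []].
Qed.

Lemma time_leE (t : option nat) n : time_le t n = time_lt t (Some n.+1).
Proof. by case: t. Qed.

Lemma first_time_ge (b : nat -> bool) n :
  ~~ time_lt (first_time b) (Some n) = all (fun k => ~~ b k) (iota 0 n).
Proof.
rewrite /first_time; case: pselect => [h | h] /=; last first.
  by apply/esym/allP => k _; apply/negP => bk; apply: h; exists k.
rewrite -leqNgt; case: ex_minnP => m bm mmin; apply/idP/allP => /=.
  move=> nm k; rewrite mem_iota add0n => /andP[_ kn]; apply/negP => /mmin mk.
  by have := leq_trans nm mk; rewrite leqNgt kn.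
move=> hn; rewrite leqNgt; apply/negP => mn.
by have := hn m; rewrite mem_iota add0n mn bm => /(_ isT).
Qed.

(** As long as a first time has not occurred before n, it occurs at n exactly
    when its condition holds at n; this makes the current draw decide. *)
Lemma first_time_now (b : nat -> bool) n :
  ~~ time_lt (first_time b) (Some n) -> (first_time b == Some n) = b n.
Proof.
move=> ge; have := first_time_ge b n.+1; rewrite time_lt_S negb_or ge.
rewrite -addn1 iotaD all_cat -first_time_ge ge /= andbT add0n.
exact: (can_inj negbK).
Qed.

Section Payoff.
Context {R : realType} {E : countType} {d : measure_display}.
Context {Omega : measurableType d}.
Variables (X : nat -> Omega -> E) (alpha : R).

Lemma payoffE (f g h : E -> R) (s t : Omega -> option nat) w :
  payoff X alpha f g h s t w =
  match s w, t w with
  | Some m, Some n => if (m < n)%N then alpha ^+ m * f (X m w)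
      else if (n < m)%N then alpha ^+ n * g (X n w) else alpha ^+ m * h (X m w)
  | Some m, None => alpha ^+ m * f (X m w)
  | None, Some n => alpha ^+ n * g (X n w)
  | None, None => 0
  end.
Proof.
rewrite /payoff /stopped_reward; case: (s w) (t w) => [m|] [n|] /=; last first.
- by rewrite !mul0r !addr0.
- by rewrite mulr1 !mul0r add0r addr0.
- by rewrite mulr1 mul0r mulr0 !addr0.
rewrite andbT (_ : (Some m == Some n) = (m == n)) //.
by case: ltngtP => _; rewrite /= ?mulr1 ?mulr0 ?addr0 ?add0r.
Qed.

(** Exchanging the players and negating the rewards turns the minimizer into a
    maximizer, so that every estimate is only needed for player 1. *)
Lemma payoff_swap (f g h : E -> R) (s t : Omega -> option nat) w :
  payoff X alpha f g h s t w =
  - payoff X alpha (fun e => - g e) (fun e => - f e) (fun e => - h e) t s w.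
Proof.
rewrite !payoffE; case: (s w) (t w) => [m|] [n|]; rewrite ?oppr0 ?mulrN ?opprK //.
by case: ltngtP => [_|_|->]; rewrite /= ?mulrN ?opprK.
Qed.

Lemma payoff_opp (f g h : E -> R) (s t : Omega -> option nat) w :
  payoff X alpha (fun e => - f e) (fun e => - g e) (fun e => - h e) s t w =
  - payoff X alpha f g h s t w.
Proof.
rewrite !payoffE; case: (s w) (t w) => [m|] [n|]; rewrite ?oppr0 ?mulrN //.
by case: ltngtP => _; rewrite /= ?mulrN.
Qed.

End Payoff.

(** Reward of stopping now in state e, against an opponent who stops now with
    probability q e. *)
Definition stop_gain {R : realType} {E : Type} (f h q : E -> R) (e : E) : R :=
  q e * h e + (1 - q e) * f e.

(** Reward of not stopping now in state e, when the game continues with the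
    value W of the next state. *)
Definition continuation_gain {R : realType} {E : finType} (Pi : E -> E -> R)
    (alpha : R) (g q W : E -> R) (e : E) : R :=
  q e * g e + (1 - q e) * (alpha * \sum_e' Pi e e' * W e').

Section Verification.
Context {R : realType} {E : finType} {Pi : E -> E -> R} {d : measure_display}.
Context {Omega : measurableType d} {P : E -> probability Omega R}.
Context {X : nat -> Omega -> E} {xi eta : nat -> Omega -> R}.
Hypothesis rc : randomized_chain Pi P X xi eta.
Hypothesis Pi_ge0 : forall e e', 0 <= Pi e e'.
Variables (x : E) (alpha : R) (f g h q : E -> R) (tau : Omega -> option nat).
Hypothesis alpha01 : 0 <= alpha < 1.
Hypothesis q01 : forall e, 0 <= q e <= 1.
Hypothesis tauT : stopping_times X xi tau.

Let hist := history (X := X) (xi := xi) (eta := eta).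

Let sigma := markov_time X eta q.

Definition alive n w := ~~ time_lt (tau w) (Some n) && ~~ time_lt (sigma w) (Some n).

Definition stops n e w := [&& alive n w, X n w == e & tau w == Some n].

Definition continues n e w := [&& alive n w, X n w == e & tau w != Some n].

Definition draws n e w := eta n w <= q e.

Lemma hist_tau_lt Kx Ki Kj n : `I_n `<=` Kx -> `I_n `<=` Ki ->
  hist Kx Ki Kj [set w | time_lt (tau w) (Some n)].
Proof.
move=> nx ni; case: n nx ni => [|n] nx ni.
  rewrite (_ : [set w | _] = set0); first exact: sigma_algebra0.
  by apply/seteqP; split => w //=; case: (tau w).
rewrite (_ : [set w | _] = [set w | time_le (tau w) n]).
  have Ht : player_filtration X xi n [set w | time_le (tau w) n] by exact: tauT.
  have H := @history_filtration _ _ _ _ X xi eta Kx Ki Kj n nx ni.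
  exact: (H _ Ht).
by apply/funext => w /=; rewrite time_leE.
Qed.

Lemma hist_tau_eq Kx Ki Kj n : `I_n.+1 `<=` Kx -> `I_n.+1 `<=` Ki ->
  hist Kx Ki Kj [set w | tau w == Some n].
Proof.
move=> nx ni; have sF := history_sigma_algebra (X:=X) (xi:=xi) (eta:=eta) Kx Ki Kj.
rewrite (_ : [set w | _] =
    [set w | time_lt (tau w) (Some n.+1) && ~~ time_lt (tau w) (Some n)]).
  apply: (sigma_algebra_and sF (b := fun w => time_lt (tau w) (Some n.+1))).
    exact: hist_tau_lt.
  apply: (sigma_algebra_not sF (b := fun w => time_lt (tau w) (Some n))).
  by apply: hist_tau_lt => k /= kn; [apply: nx | apply: ni]; exact: ltnW.
apply/seteqP; split => w /=; first by move=> /eqP ->; rewrite /= ltnn ltnSn.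
by rewrite time_lt_S => /andP[/orP[->|]].
Qed.

Lemma hist_sigma_ge Kx Ki Kj n : `I_n `<=` Kx -> `I_n `<=` Kj ->
  hist Kx Ki Kj [set w | ~~ time_lt (sigma w) (Some n)].
Proof.
move=> nx nj; have sF := history_sigma_algebra (X:=X) (xi:=xi) (eta:=eta) Kx Ki Kj.
rewrite (_ : [set w | _] =
  [set w | all (fun k => ~~ ((k < n)%N && (eta k w <= q (X k w)))) (iota 0 n)]).
  apply: (sigma_algebra_all sF (iota 0 n)
    (b := fun k w => ~~ ((k < n)%N && (eta k w <= q (X k w))))) => k.
  apply: (sigma_algebra_not sF (b := fun w => (k < n)%N && (eta k w <= q (X k w)))).
  case: ltnP => kn /=.
    by apply: history_opponent_draw; [exact: nx | exact: nj].
  exact: (sigma_algebra_not sF (sigma_algebra_true sF)).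
apply/funext => w /=; congr is_true; rewrite first_time_ge; apply: eq_in_all => k.
by rewrite mem_iota add0n => /andP[_ ->].
Qed.

Lemma hist_alive Kx Ki Kj n : `I_n `<=` Kx -> `I_n `<=` Ki -> `I_n `<=` Kj ->
  hist Kx Ki Kj [set w | alive n w].
Proof.
move=> nx ni nj.
have sF := history_sigma_algebra (X:=X) (xi:=xi) (eta:=eta) Kx Ki Kj.
apply: (sigma_algebra_and sF (b := fun w => ~~ time_lt (tau w) (Some n))).
  by apply: (sigma_algebra_not sF (b := fun w => time_lt (tau w) (Some n)));
    exact: hist_tau_lt.
exact: hist_sigma_ge.
Qed.

Lemma hist_stops Kx Ki Kj n e : `I_n.+1 `<=` Kx -> `I_n.+1 `<=` Ki -> `I_n `<=` Kj ->
  hist Kx Ki Kj [set w | stops n e w].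
Proof.
move=> nx ni nj.
have sF := history_sigma_algebra (X:=X) (xi:=xi) (eta:=eta) Kx Ki Kj.
apply: (sigma_algebra_and sF).
  by apply: hist_alive => // k /= kn; [apply: nx | apply: ni]; exact: ltnW.
apply: (sigma_algebra_and sF (b := fun w => X n w == e)); last exact: hist_tau_eq.
by apply: history_state; apply: nx; exact: ltnSn.
Qed.

Lemma hist_continues Kx Ki Kj n e :
  `I_n.+1 `<=` Kx -> `I_n.+1 `<=` Ki -> `I_n `<=` Kj ->
  hist Kx Ki Kj [set w | continues n e w].
Proof.
move=> nx ni nj.
have sF := history_sigma_algebra (X:=X) (xi:=xi) (eta:=eta) Kx Ki Kj.
apply: (sigma_algebra_and sF).
  by apply: hist_alive => // k /= kn; [apply: nx | apply: ni]; exact: ltnW.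
apply: (sigma_algebra_and sF (b := fun w => X n w == e)).
  by apply: history_state; apply: nx; exact: ltnSn.
by apply: (sigma_algebra_not sF (b := fun w => tau w == Some n)); exact: hist_tau_eq.
Qed.

Lemma hist_draws Kx Ki Kj n e : Kj n -> hist Kx Ki Kj [set w | draws n e w].
Proof.
move=> Kn; apply: history_opponent.
apply: (@sigma_gen_preimage _ _ _ eta _ n [set y | y <= q e]) => //.
exact: measurable_ler.
Qed.

Let meas (b : Omega -> bool) : hist setT setT setT [set w | b w] ->
  measurable [set w | b w].
Proof. exact: (history_measurable rc x). Qed.

Lemma measurable_stops n e : measurable [set w | stops n e w].
Proof. by apply: meas; exact: hist_stops. Qed.

Lemma measurable_continues n e : measurable [set w | continues n e w].
Proof. by apply: meas; exact: hist_continues. Qed.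

Lemma measurable_draws n e : measurable [set w | draws n e w].
Proof. by apply: meas; exact: hist_draws. Qed.

Notation pr := (prob (P x)).

Lemma prob_draw n e (b : Omega -> bool) : hist setT setT `I_n [set w | b w] ->
  pr (fun w => b w && draws n e w) = q e * pr b.
Proof.
move=> hb; rewrite /prob -(fineM (x := (q e)%:E)) //; last first.
  by rewrite fin_num_measure //; exact: (history_measurable rc x hb).
rewrite -(draw_indep_history rc x (q01 e) hb); congr (fine (P x _)).
by apply/seteqP; split => w /= /andP.
Qed.

Lemma prob_no_draw n e (b : Omega -> bool) : hist setT setT `I_n [set w | b w] ->
  pr (fun w => b w && ~~ draws n e w) = (1 - q e) * pr b.
Proof.
move=> hb; rewrite prob_split ?prob_draw //; first by ring.
  exact: (history_measurable rc x hb).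
exact: measurable_draws.
Qed.

(** Nobody stops at time n in state e, and the chain jumps to e'. *)
Definition moves n e e' w := [&& continues n e w, ~~ draws n e w & X n.+1 w == e'].

Lemma measurable_moves n e e' : measurable [set w | moves n e e' w].
Proof.
have sF := history_sigma_algebra (X:=X) (xi:=xi) (eta:=eta) setT setT setT.
apply: meas; apply: (sigma_algebra_and sF); first exact: hist_continues.
apply: (sigma_algebra_and sF (b := fun w => ~~ draws n e w));
  last exact: history_state.
by apply: (sigma_algebra_not sF (b := fun w => draws n e w)); exact: hist_draws.
Qed.

(** No stop at time n is an event of the history up to time n, so the Markov
    property applies to it. *)
Lemma prob_moves n e e' :
  pr (moves n e e') = Pi e e' * ((1 - q e) * pr (continues n e)).
Proof.
rewrite -(@prob_no_draw n); last exact: hist_continues.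
have sF := history_sigma_algebra (X:=X) (xi:=xi) (eta:=eta) `I_n.+1 setT setT.
have hb : hist `I_n.+1 setT setT [set w | continues n e w && ~~ draws n e w].
  apply: (sigma_algebra_and sF); first exact: hist_continues.
  by apply: (sigma_algebra_not sF (b := fun w => draws n e w)); exact: hist_draws.
have := chain_step_history rc x (Pi_ge0 e e') hb.
set A := (X in P x X = _); set B := (X in (_ * P x X)%E).
have -> : A = [set w | moves n e e' w].
  apply/seteqP; split => w; rewrite /A /moves /=.
    by move=> [/andP[-> ->] [_ ->]]; rewrite eqxx.
  move=> /and3P[c -> /eqP ->]; rewrite c; split => //.
  by case/and3P: c => _ /eqP ->.
have -> : B = [set w | continues n e w && ~~ draws n e w].
  rewrite /B; apply/seteqP; split => w /=; first by case.
  by move=> /andP[c ->]; rewrite c; split=> //; case/and3P: c => _ /eqP ->.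
rewrite /prob => ->; rewrite fineM // fin_num_measure //.
exact: (history_measurable rc x hb).
Qed.


Variables (W : nat -> E -> R) (B : R).
Hypothesis fB : forall e, `|f e| <= B.
Hypothesis gB : forall e, `|g e| <= B.
Hypothesis hB : forall e, `|h e| <= B.
Hypothesis WB : forall n e, `|W n e| <= B.

Let pay := payoff X alpha f g h tau sigma.

(** The payoff when a game still running at time n is bought out at the value
    W n of the current state. It interpolates between W 0 at the initial state
    and the payoff of the full game. *)
Definition truncated_payoff n w :=
  if alive n w then alpha ^+ n * W n (X n w) else pay w.

(** Conditionally on the state e at time n, the change of the truncated payoff
    from n to n + 1 without its discount factor. Writing it with indicators
    reduces its mean to the probabilities computed above. *)
Definition increment n e w : R :=
  h e * (stops n e w && draws n e w)%:R
  + f e * (stops n e w && ~~ draws n e w)%:R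
  + g e * (continues n e w && draws n e w)%:R
  + alpha * (\sum_e' W n.+1 e' * (moves n e e' w)%:R)
  + - W n e * (stops n e w)%:R + - W n e * (continues n e w)%:R.

Lemma aliveS n w :
  alive n.+1 w = [&& alive n w, tau w != Some n & ~~ draws n (X n w) w].
Proof.
rewrite /alive !time_lt_S !negb_or.
case: (boolP (time_lt (sigma w) (Some n))) => sn.
  by rewrite /= !andbF.
by rewrite /draws -(first_time_now sn) /= andbT !andbA.
Qed.

Lemma pay_stopped n w : alive n w -> ~~ alive n.+1 w ->
  pay w = alpha ^+ n * (if tau w == Some n then
    if draws n (X n w) w then h (X n w) else f (X n w) else g (X n w)).
Proof.
rewrite aliveS => al; rewrite al /=; case/andP: al => tn sn.
rewrite /draws -(first_time_now sn) -/(markov_time X eta q w) -/(sigma w).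
rewrite /pay payoffE; move: tn sn.
case: (tau w) (sigma w) => [m|] [k|] //=; rewrite -?leqNgt.
- move=> nm nk; rewrite !(inj_eq Some_inj) negb_and !negbK.
  have [mn _|mn /= /eqP kn] := eqVneq m n.
    subst m; have [->|kn] := eqVneq k n; first by rewrite !ltnn.
    by rewrite ltn_neqAle eq_sym kn nk.
  by subst k; rewrite ltnNge nm /= ltn_neqAle eq_sym mn nm.
- by move=> nm _; rewrite andbT negbK => /eqP [->]; rewrite eqxx.
- by move=> _ nk /negPn /eqP [->].
Qed.

Lemma pay_bound n w : alive n w -> `|pay w| <= B * alpha ^+ n.
Proof.
case/andP: alpha01 => a0 a1; have B0 : 0 <= B by exact: le_trans (fB x).
have a_n m : (n <= m)%N -> forall u : E -> R, (forall e, `|u e| <= B) ->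
    forall e, `|alpha ^+ m * u e| <= B * alpha ^+ n.
  move=> nm u uB e; rewrite normrM mulrC (ger0_norm (exprn_ge0 m a0)).
  apply: ler_pM; rewrite ?exprn_ge0 //.
  by apply: ler_wiXn2l => //; exact: ltW.
case/andP; rewrite /pay payoffE.
case: (tau w) (sigma w) => [m|] [k|] //=; rewrite -?leqNgt => nm nk.
- by case: ltngtP => _; exact: a_n.
- exact: a_n.
- exact: a_n.
- by rewrite normr0 mulr_ge0 ?exprn_ge0.
Qed.

Lemma truncated_payoff0 : truncated_payoff 0 = fun w => W 0%N (X 0%N w).
Proof.
apply/funext => w; rewrite /truncated_payoff /alive.
by case: (tau w) (sigma w) => [?|] [?|] /=; rewrite expr0 mul1r.
Qed.

Lemma truncated_payoff_step n : truncated_payoff n.+1 =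
  fun w => truncated_payoff n w + alpha ^+ n * \sum_e increment n e w.
Proof.
apply/funext => w; rewrite (bigD1 (X n w)) //= big1 ?addr0 => [|e ne]; last first.
  have Xe : (X n w == e) = false by rewrite eq_sym; exact: negbTE.
  rewrite /increment /moves /stops /continues Xe !andbF /= !mulr0 !add0r !addr0.
  by rewrite big1 ?mulr0 // => e' _; rewrite mulr0.
have moveE : \sum_e' W n.+1 e' * (moves n (X n w) e' w)%:R =
    W n.+1 (X n.+1 w) * (alive n.+1 w)%:R.
  rewrite (bigD1 (X n.+1 w)) //= big1 ?addr0 => [|e ne].
    by rewrite /moves /continues aliveS !eqxx /= andbT !andbA.
  have Xe : (X n.+1 w == e) = false by rewrite eq_sym; exact: negbTE.
  by rewrite /moves Xe !andbF mulr0.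
rewrite /increment moveE /truncated_payoff /stops /continues eqxx /=.
case: (boolP (alive n w)) => al /=; last first.
  by rewrite aliveS (negbTE al) /= !mulr0 !addr0 !mulr0 addr0.
case: (boolP (alive n.+1 w)) => al'; last rewrite (pay_stopped al al').
  move: al'; rewrite aliveS al /= => /andP[/negbTE -> /negbTE ->] /=.
  by rewrite exprS; ring.
move: al'; rewrite aliveS al /=.
by case: (tau w == _) (draws n (X n w) w) => [] [] //= _; ring.
Qed.

Lemma bounded_increment n e : bounded_rv (increment n e).
Proof.
have ms := measurable_stops n e; have mc := measurable_continues n e.
have md := measurable_draws n e.
have sm := measurable_sigma_algebra Omega.
have mnd := sigma_algebra_not sm md.
have I := @bounded_rv_indicator R d Omega.
rewrite /increment; do !apply: bounded_rvD; apply: bounded_rvZ.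
- by apply: I; exact: (sigma_algebra_and sm ms md).
- by apply: I; exact: (sigma_algebra_and sm ms mnd).
- by apply: I; exact: (sigma_algebra_and sm mc md).
- apply: bounded_rv_sum => e'; apply: bounded_rvZ; apply: I.
  exact: measurable_moves.
- exact: I.
- exact: I.
Qed.

Lemma mean_increment n e : mean (P x) (increment n e) =
  pr (stops n e) * stop_gain f h q e
  + pr (continues n e) * continuation_gain Pi alpha g q (W n.+1) e
  - (pr (stops n e) + pr (continues n e)) * W n e.
Proof.
have ms := measurable_stops n e; have mc := measurable_continues n e.
have md := measurable_draws n e.
have sm := measurable_sigma_algebra Omega.
have mnd := sigma_algebra_not sm md.
have mi (b : Omega -> bool) :
    measurable [set w | b w] -> bounded_rv (fun w => (b w)%:R : R).
  exact: bounded_rv_indicator.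
have mZ (b : Omega -> bool) (c : R) : measurable [set w | b w] ->
    bounded_rv (fun w => c * (b w)%:R).
  by move=> /mi; exact: bounded_rvZ.
have b1 := sigma_algebra_and sm ms md; have b2 := sigma_algebra_and sm ms mnd.
have b3 := sigma_algebra_and sm mc md.
have mm e' := measurable_moves n e e'.
have bm : bounded_rv (fun w => \sum_e' W n.+1 e' * (moves n e e' w)%:R).
  by apply: bounded_rv_sum => e'; exact: mZ.
rewrite /increment !meanD; do ?[exact: mZ | exact: bounded_rvZ | apply: bounded_rvD].
rewrite !meanZ; do ?[exact: mi | exact: bm].
rewrite mean_sum; last by move=> e'; exact: mZ.
rewrite !mean_indicator //.
have -> : \sum_e' mean (P x) (fun w => W n.+1 e' * (moves n e e' w)%:R) =
    (1 - q e) * pr (continues n e) * \sum_e' Pi e e' * W n.+1 e'.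
  rewrite mulr_sumr; apply: eq_bigr => e' _.
  by rewrite meanZ ?mean_indicator ?prob_moves //; [ring | exact: mi].
have hs : hist setT setT `I_n [set w | stops n e w] by exact: hist_stops.
have hc : hist setT setT `I_n [set w | continues n e w] by exact: hist_continues.
rewrite prob_no_draw // !prob_draw // /stop_gain /continuation_gain.
by ring.
Qed.

Lemma bounded_start : bounded_rv (fun w => W 0%N (X 0%N w)).
Proof.
split; last by exists B => w.
have -> : (fun w => W 0%N (X 0%N w)) = (fun w => \sum_e W 0%N e * (X 0%N w == e)%:R).
  apply/funext => w; rewrite (bigD1 (X 0%N w)) //= eqxx mulr1 big1 ?addr0 // => e ne.
  by rewrite eq_sym (negbTE ne) mulr0.
suff [] : bounded_rv (fun w => \sum_e W 0%N e * (X 0%N w == e)%:R) by [].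
apply: bounded_rv_sum => e; apply: bounded_rvZ; apply: bounded_rv_indicator.
by apply: meas; exact: history_state.
Qed.

Lemma mean_start : mean (P x) (fun w => W 0%N (X 0%N w)) = W 0%N x.
Proof.
have m0 e : measurable [set w | X 0%N w == e] by apply: meas; exact: history_state.
have bi e := @bounded_rv_indicator R _ _ _ (m0 e).
have px : pr (fun w => X 0%N w == x) = 1.
  have [_ start _] := rc_chain rc x.
  rewrite /prob (_ : [set w | _] = X 0%N @^-1` [set x]) ?start //.
  by apply/seteqP; split => w /= /eqP.
have pe e : e != x -> pr (fun w => X 0%N w == e) = 0.
  move=> ex; apply/eqP; rewrite eq_le prob_ge0 andbT -(lerD2r 1) add0r -[in leLHS]px.
  rewrite -!mean_indicator // -meanD // -[leRHS](mean_cst (P x)).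
  apply: mean_le => [||w]; first exact: bounded_rvD.
    by split; [exact: measurable_cst | exists 1 => w; rewrite normr1].
  have [->|_] := eqVneq (X 0%N w) e; last by rewrite add0r; case: eqP.
  by rewrite (negbTE ex) addr0.
have -> : (fun w => W 0%N (X 0%N w)) = (fun w => \sum_e W 0%N e * (X 0%N w == e)%:R).
  apply/funext => w; rewrite (bigD1 (X 0%N w)) //= eqxx mulr1 big1 ?addr0 // => e ne.
  by rewrite eq_sym (negbTE ne) mulr0.
rewrite mean_sum => [|e]; last exact: bounded_rvZ.
rewrite (bigD1 x) //= meanZ // mean_indicator // px mulr1 big1 ?addr0 // => e ne.
by rewrite meanZ // mean_indicator // pe // mulr0.
Qed.

Lemma bounded_truncated n : bounded_rv (truncated_payoff n).
Proof.
elim: n => [|n IHn].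
  by rewrite truncated_payoff0; exact: bounded_start.
rewrite truncated_payoff_step.
apply: bounded_rvD => //; apply: bounded_rvZ; apply: bounded_rv_sum => e.
exact: bounded_increment.
Qed.

Lemma truncated_payoff_close n w :
  `|pay w - truncated_payoff n w| <= 2 * B * alpha ^+ n.
Proof.
case/andP: alpha01 => a0 a1; have B0 : 0 <= B by exact: le_trans (fB x).
rewrite /truncated_payoff; case: ifP => al; last first.
  by rewrite subrr normr0 !mulr_ge0 ?exprn_ge0.
apply: le_trans (ler_normB _ _) _.
rewrite -mulrA mulr2n mulrDl mul1r lerD ?pay_bound //.
by rewrite normrM mulrC (ger0_norm (exprn_ge0 n a0)) ler_wpM2r ?exprn_ge0.
Qed.

Lemma geometric_cvg0 (c : R) : c * alpha ^+ n @[n --> \oo] --> 0.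
Proof.
apply: cvg_geometric; case/andP: alpha01 => a0 a1.
by rewrite ger0_norm.
Qed.

(** Measurability comes from the truncated payoffs, which are finite sums of
    indicators and converge geometrically. *)
Lemma bounded_payoff : bounded_rv pay.
Proof.
split; last first.
  exists B => w; have := @pay_bound 0 w; rewrite expr0 mulr1; apply.
  by rewrite /alive; case: (tau w) (sigma w) => [?|] [?|].
apply: (measurable_fun_cvg (h := truncated_payoff)) => [n | w _].
  by case: (bounded_truncated n).
have lim (c : R) : pay w + c * alpha ^+ n @[n --> \oo] --> pay w.
  rewrite -[X in _ --> X]addr0.
  by apply: cvgD; [exact: cvg_cst | exact: geometric_cvg0].
apply: squeeze_cvgr (lim (- (2 * B))) (lim (2 * B)).
apply: nearW => n; have := truncated_payoff_close n w.
by rewrite ler_norml mulNr => /andP[h1 h2]; apply/andP; split; lra.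
Qed.

(** If the average of the two gains, weighted by the probabilities with which
    tau stops and continues, never exceeds W n, then the mean of the truncated
    payoff decreases in n. It starts at W 0 x and tends to the mean payoff.
    The hypothesis is weighted by those probabilities, rather than required of
    each gain, so as to cover both arbitrary stopping times and the exact
    value of a randomized one. *)
Lemma mean_payoff_le :
    (forall n e, pr (stops n e) * stop_gain f h q e
      + pr (continues n e) * continuation_gain Pi alpha g q (W n.+1) e
      <= (pr (stops n e) + pr (continues n e)) * W n e) ->
  mean (P x) pay <= W 0%N x.
Proof.
move=> super; case/andP: alpha01 => a0 a1.
have bsum n : bounded_rv (fun w => \sum_e increment n e w).
  by apply: bounded_rv_sum => e; exact: bounded_increment.
have decr n : mean (P x) (truncated_payoff n) <= W 0%N x.
  elim: n => [|n IHn]; first by rewrite truncated_payoff0 mean_start.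
  rewrite truncated_payoff_step meanD; [|exact: bounded_truncated|exact: bounded_rvZ].
  rewrite meanZ // mean_sum; last by move=> e; exact: bounded_increment.
  rewrite -[leRHS]addr0 lerD // mulr_ge0_le0 ?exprn_ge0 // sumr_le0 // => e _.
  by rewrite mean_increment subr_le0.
have bound n : mean (P x) pay <= W 0%N x + 2 * B * alpha ^+ n.
  have bc (c : R) : bounded_rv (fun _ : Omega => c).
    by split; [exact: measurable_cst | exists `|c|].
  rewrite (le_trans _ (lerD (decr n) (lexx _))) // -(mean_cst (P x) (2 * B * _)).
  rewrite -meanD //; last exact: bounded_truncated.
  apply: mean_le => [||w]; first exact: bounded_payoff.
    by apply: bounded_rvD => //; exact: bounded_truncated.
  by have := truncated_payoff_close n w; rewrite ler_norml => /andP[h1 h2]; lra.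
have lim : W 0%N x + 2 * B * alpha ^+ n @[n --> \oo] --> W 0%N x.
  rewrite -[X in _ --> X]addr0.
  by apply: cvgD; [exact: cvg_cst | exact: geometric_cvg0].
by apply: (cvgr_to_ge lim); exact: nearW.
Qed.

End Verification.

(** * Randomized times and the one-shot deviation principle *)

Section RoleSwap.
Context {R : realType} {E : finType} {Pi : E -> E -> R} {d : measure_display}.
Context {Omega : measurableType d} {P : E -> probability Omega R}.
Context {X : nat -> Omega -> E} {xi eta : nat -> Omega -> R}.

Lemma randomized_chain_swap : randomized_chain Pi P X xi eta ->
  randomized_chain Pi P X eta xi.
Proof.
move=> [chain u1 u2 ind]; split => // x A B C hA hB hC.
by rewrite setIAC ind // muleAC.
Qed.

Lemma history_swap (Kx Ki Kj : set nat) :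
  @history R E d Omega X xi eta Kx Ki Kj = @history R E d Omega X eta xi Kx Kj Ki.
Proof.
rewrite /history; congr (<<s _ >>); apply/seteqP; split => D.
- by move=> [A [B [C [hA hB hC ->]]]]; exists A, C, B; rewrite setIAC.
- by move=> [A [B [C [hA hB hC ->]]]]; exists A, C, B; rewrite setIAC.
Qed.

End RoleSwap.

Section RandomizedTimes.
Context {R : realType} {E : finType} {d : measure_display}.
Context {Omega : measurableType d}.
Variables (X : nat -> Omega -> E) (xi : nat -> Omega -> R).

(** Thresholds may depend on time, so that a deviation at time 0 only is again
    of this form. *)
Definition randomized_time (p : nat -> E -> R) (w : Omega) : option nat :=
  first_time (fun n => xi n w <= p n (X n w)).

Lemma randomized_time_stopping p :
  stopping_times X xi (randomized_time p).
Proof.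
move=> n; have sF : sigma_algebra setT (player_filtration X xi n).
  exact: smallest_sigma_algebra.
rewrite (_ : [set w | _] = [set w | ~~ all (fun k => ~~ ((k <= n)%N &&
    (xi k w <= p k (X k w)))) (iota 0 n.+1)]).
  apply: (sigma_algebra_not sF (b := fun w => all (fun k => ~~ ((k <= n)%N &&
    (xi k w <= p k (X k w)))) (iota 0 n.+1))).
  apply: (sigma_algebra_all sF (iota 0 n.+1) (b := fun k w => ~~ ((k <= n)%N &&
    (xi k w <= p k (X k w))))) => k.
  apply: (sigma_algebra_not sF (b := fun w => (k <= n)%N &&
    (xi k w <= p k (X k w)))).
  case: leqP => kn /=; last exact: (sigma_algebra_not sF (sigma_algebra_true sF)).
  apply: (sigma_algebra_comp sF (b := fun e w => xi k w <= p k e)) => e.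
    apply: sub_sigma_algebra; left.
    rewrite (_ : [set w | _] = X k @^-1` [set e]); first exact: sigma_gen_preimage.
    by apply/seteqP; split => w /= /eqP.
  apply: sub_sigma_algebra; right.
  apply: (@sigma_gen_preimage _ _ _ xi _ k [set y | y <= p k e]) => //.
  exact: measurable_ler.
apply/funext => w /=; rewrite time_leE -[time_lt _ _]negbK first_time_ge.
congr (is_true (~~ _)); apply: eq_in_all => k.
by rewrite mem_iota add0n ltnS => /andP[_ ->].
Qed.

End RandomizedTimes.
Arguments randomized_time_stopping {R E d Omega} X xi p.

Lemma finite_bound (R : realType) (E : finType) (u : E -> R) :
  exists B, forall e, `|u e| <= B.
Proof.
exists (\sum_e `|u e|) => e; rewrite (bigD1 e) //= lerDl.
by apply: sumr_ge0 => i _.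
Qed.

Section OptimalStopping.
Context {R : realType} {E : finType} {Pi : E -> E -> R} {d : measure_display}.
Context {Omega : measurableType d} {P : E -> probability Omega R}.
Context {X : nat -> Omega -> E} {xi eta : nat -> Omega -> R}.
Hypothesis rc : randomized_chain Pi P X xi eta.
Hypothesis Pi_ge0 : forall e e', 0 <= Pi e e'.
Variables (alpha : R) (f g h q : E -> R).
Hypothesis alpha01 : 0 <= alpha < 1.
Hypothesis q01 : forall e, 0 <= q e <= 1.

Let sigma := markov_time X eta q.

Lemma common_bound (W : nat -> E -> R) :
    (exists B, forall n e, `|W n e| <= B) -> exists B, [/\ forall e, `|f e| <= B,
    forall e, `|g e| <= B, forall e, `|h e| <= B & forall n e, `|W n e| <= B].
Proof.
move=> [B0 WB]; have [B1 fB] := finite_bound f; have [B2 gB] := finite_bound g.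
have [B3 hB] := finite_bound h.
exists (Num.max (Num.max B0 B1) (Num.max B2 B3)).
by split => *; rewrite !le_max ?WB ?fB ?gB ?hB ?orbT.
Qed.

Lemma payoff_bounded (x : E) tau : stopping_times X xi tau ->
  bounded_rv (payoff X alpha f g h tau sigma).
Proof.
move=> tauT; have [|B [fB gB hB WB]] := @common_bound (fun _ _ => 0).
  by exists 0 => *; rewrite normr0.
exact: (bounded_payoff rc x q alpha01 tauT fB gB hB WB).
Qed.

Lemma J1_mean x tau : stopping_times X xi tau ->
  J1 P X alpha f g h x tau sigma =
    (mean (P x) (payoff X alpha f g h tau sigma))%:E.
Proof. by move=> tauT; apply: expectation_mean; exact: payoff_bounded. Qed.

Lemma J1_le_supersolution (W : E -> R) :
    (forall e, stop_gain f h q e <= W e) ->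
    (forall e, continuation_gain Pi alpha g q W e <= W e) ->
  forall x tau, stopping_times X xi tau ->
  (J1 P X alpha f g h x tau sigma <= (W x)%:E)%E.
Proof.
move=> stopW contW x tau tauT; rewrite J1_mean // lee_fin.
have [|B [fB gB hB WB]] := @common_bound (fun=> W).
  by have [B WB] := finite_bound W; exists B.
apply: (mean_payoff_le rc Pi_ge0 alpha01 q01 tauT fB gB hB WB) => n e.
by rewrite mulrDl lerD // ler_wpM2l ?prob_ge0.
Qed.

Section RandomizedPlay.
Variable p : nat -> E -> R.
Hypothesis p01 : forall n e, 0 <= p n e <= 1.

Let tau := randomized_time X xi p.

Let tauT : stopping_times X xi tau.
Proof. exact: randomized_time_stopping. Qed.

Let alive_at n e w := @alive R E d Omega X eta q tau n w && (X n w == e).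

Let hist_alive_at n e :
  @history R E d Omega X eta xi setT setT `I_n [set w | alive_at n e w].
Proof.
have sF := history_sigma_algebra (X:=X) (xi:=eta) (eta:=xi) setT setT `I_n.
apply: (sigma_algebra_and sF (c := fun w => X n w == e)); last exact: history_state.
by rewrite -history_swap; exact: hist_alive.
Qed.

Let prob_stops x n e :
  prob (P x) (stops (eta := eta) (X := X) q tau n e) =
  p n e * prob (P x) (alive_at n e).
Proof.
rewrite -(prob_draw (randomized_chain_swap rc) x (p01 n) e (@hist_alive_at n e)).
congr prob; apply/funext => w; rewrite /stops /alive_at -andbA.
case: (boolP (alive _ _ _ _)) => //= /andP[tn _].
by rewrite (first_time_now tn); case: eqP => [->|].
Qed.

Let prob_continues x n e :
  prob (P x) (continues (eta := eta) (X := X) q tau n e) =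
  (1 - p n e) * prob (P x) (alive_at n e).
Proof.
rewrite -(prob_no_draw (randomized_chain_swap rc) x (p01 n) e (@hist_alive_at n e)).
congr prob; apply/funext => w; rewrite /continues /alive_at -andbA.
case: (boolP (alive _ _ _ _)) => //= /andP[tn _].
by rewrite (first_time_now tn); case: eqP => [->|].
Qed.

Lemma mean_randomized_le (W : nat -> E -> R) x :
    (exists B, forall n e, `|W n e| <= B) ->
    (forall n e, p n e * stop_gain f h q e
      + (1 - p n e) * continuation_gain Pi alpha g q (W n.+1) e <= W n e) ->
  mean (P x) (payoff X alpha f g h tau sigma) <= W 0%N x.
Proof.
move=> /common_bound[B [fB gB hB WB]] superW.
apply: (mean_payoff_le rc Pi_ge0 alpha01 q01 tauT fB gB hB WB) => n e.
rewrite prob_stops prob_continues; set a := prob _ _.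
have := ler_wpM2l (prob_ge0 _ _ : 0 <= a) (superW n e).
by congr (_ <= _); ring.
Qed.

End RandomizedPlay.
End OptimalStopping.

Section RandomizedValue.
Context {R : realType} {E : finType} {Pi : E -> E -> R} {d : measure_display}.
Context {Omega : measurableType d} {P : E -> probability Omega R}.
Context {X : nat -> Omega -> E} {xi eta : nat -> Omega -> R}.
Hypothesis rc : randomized_chain Pi P X xi eta.
Hypothesis Pi_ge0 : forall e e', 0 <= Pi e e'.
Variable alpha : R.
Hypothesis alpha01 : 0 <= alpha < 1.

Lemma continuation_gain_opp (f q W : E -> R) e :
  continuation_gain Pi alpha (fun e => - f e) q (fun e => - W e) e =
  - continuation_gain Pi alpha f q W e.
Proof.
rewrite /continuation_gain (_ : \sum_e' _ = - \sum_e' Pi e e' * W e'); first ring.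
by rewrite -sumrN; apply: eq_bigr => e' _; rewrite mulrN.
Qed.

Lemma stop_gain_opp (f h q : E -> R) e :
  stop_gain (fun e => - f e) (fun e => - h e) q e = - stop_gain f h q e.
Proof. by rewrite /stop_gain; ring. Qed.

(** The upper bound for W in the game and for - W in the game with negated
    rewards combine to an equality. *)
Lemma J1_randomized (f g h q : E -> R) (p W : nat -> E -> R) x :
    (forall e, 0 <= q e <= 1) -> (forall n e, 0 <= p n e <= 1) ->
    (exists B, forall n e, `|W n e| <= B) ->
    (forall n e, W n e = p n e * stop_gain f h q e
      + (1 - p n e) * continuation_gain Pi alpha g q (W n.+1) e) ->
  J1 P X alpha f g h x (randomized_time X xi p) (markov_time X eta q) =
  (W 0%N x)%:E.
Proof.
move=> q01 p01 [B WB] WE; have tauT := randomized_time_stopping X xi p.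
rewrite (J1_mean rc) //; congr EFin; apply: le_anti; apply/andP; split.
  apply: (mean_randomized_le rc) => // [|n e]; first by exists B.
  by rewrite [leRHS]WE.
rewrite -lerN2 -mulN1r -meanZ; last exact: (payoff_bounded rc _ _ _ _ alpha01 x tauT).
under eq_fun do rewrite mulN1r -payoff_opp.
apply: (mean_randomized_le rc Pi_ge0 alpha01 q01 p01 (W := fun n e => - W n e)).
  by exists B => n e; rewrite normrN.
move=> n e; rewrite stop_gain_opp continuation_gain_opp [in leRHS]WE.
by rewrite !mulrN -opprD.
Qed.

End RandomizedValue.

Section Equilibria.
Context {R : realType} {E : finType} {Pi : E -> E -> R} {d : measure_display}.
Context {Omega : measurableType d} {P : E -> probability Omega R}.
Context {X : nat -> Omega -> E} {xi eta : nat -> Omega -> R}.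
Hypothesis rc : randomized_chain Pi P X xi eta.
Hypothesis Pi_ge0 : forall e e', 0 <= Pi e e'.
Variables (alpha : R) (f g h : E -> R).
Hypothesis alpha01 : 0 <= alpha < 1.

Lemma J1_swap (q : E -> R) x tau : stopping_times X eta tau ->
  J1 P X alpha f g h x (markov_time X xi q) tau =
  (- J1 P X alpha (fun e => - g e)%R (fun e => - f e)%R (fun e => - h e)%R x tau
    (markov_time X xi q))%E.
Proof.
move=> tauT; have rc' := randomized_chain_swap rc.
have bp := payoff_bounded rc' (fun e => - g e) (fun e => - f e) (fun e => - h e) q
  alpha01 x tauT.
have pE : payoff X alpha f g h (markov_time X xi q) tau = fun w => - 1 *
    payoff X alpha (fun e => - g e) (fun e => - f e) (fun e => - h e) tau
      (markov_time X xi q) w.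
  by apply/funext => w; rewrite payoff_swap mulN1r.
rewrite /J1 (expectation_mean (P x) bp) pE expectation_mean; last exact: bounded_rvZ.
by rewrite meanZ // mulN1r.
Qed.

(** Neither player gains by stopping now, nor by waiting for one step, when the
    strategies p and q with value W are followed afterwards. *)
Definition one_shot_optimal (p q W : E -> R) : Prop := forall e,
  [/\ stop_gain f h q e <= W e, continuation_gain Pi alpha g q W e <= W e,
      W e <= stop_gain g h p e & W e <= continuation_gain Pi alpha f p W e].

(** The one-shot deviation principle. Necessity: stopping now, or waiting once,
    and following the own strategy afterwards are admissible deviations with
    an explicit value. Sufficiency: the four inequalities say that W is a
    supersolution of the stopping problem of player 1 and a subsolution of
    that of player 2, so no stopping time does better. *)
Lemma equilibriumP (p q W : E -> R) :
    (forall e, 0 <= p e <= 1) -> (forall e, 0 <= q e <= 1) ->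
    (forall e, W e = p e * stop_gain f h q e
      + (1 - p e) * continuation_gain Pi alpha g q W e) ->
  global_markovian_equilibrium P X xi eta alpha f g h p q <->
  one_shot_optimal p q W.
Proof.
move=> p01 q01 WE; have rc' := randomized_chain_swap rc.
have WB : exists B, forall (n : nat) e, `|W e| <= B.
  by have [B WB] := finite_bound W; exists B.
have tau1T := randomized_time_stopping X xi (fun=> p).
have tau2T := randomized_time_stopping X eta (fun=> q).
have JW x : J1 P X alpha f g h x (markov_time X xi p) (markov_time X eta q) =
    (W x)%:E.
  exact: (J1_randomized rc Pi_ge0 alpha01 (p := fun=> p) (W := fun=> W)).
split => [[_ _ eqm] | shot].
- (* the one-shot deviation: randomize by r at time 0, then follow p *)
  have dev1 (r : R) e : 0 <= r <= 1 -> r * stop_gain f h q e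
      + (1 - r) * continuation_gain Pi alpha g q W e <= W e.
    move=> r01.
    pose r' n := if n is 0%N then fun=> r else p.
    pose W' n e := if n is 0%N then r * stop_gain f h q e
      + (1 - r) * continuation_gain Pi alpha g q W e else W e.
    have JW' : J1 P X alpha f g h e (randomized_time X xi r') (markov_time X eta q) =
        (W' 0%N e)%:E.
      apply: (J1_randomized rc) => //.
      - by case.
      - have [B0 W0B] := finite_bound (W' 0%N); have [B WB'] := finite_bound W.
        by exists (Num.max B0 B) => -[|n] e'; rewrite le_max ?W0B ?WB' ?orbT.
      - by case=> [|n] e' //; exact: WE.
    rewrite -lee_fin -[leLHS]JW' -JW; case: (eqm e) => <- _.
    apply: ereal_sup_ubound; exists (randomized_time X xi r') => //.
    exact: randomized_time_stopping.
  (* the same deviation of player 2, read in the swapped and negated game *)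
  have dev2 (r : R) e : 0 <= r <= 1 -> W e <= r * stop_gain g h p e
      + (1 - r) * continuation_gain Pi alpha f p W e.
    move=> r01.
    pose r' n := if n is 0%N then fun=> r else q.
    pose W' n e := if n is 0%N then r * stop_gain g h p e
      + (1 - r) * continuation_gain Pi alpha f p W e else W e.
    have JW' : J1 P X alpha f g h e (markov_time X xi p) (randomized_time X eta r') =
        (W' 0%N e)%:E.
      rewrite J1_swap; last exact: randomized_time_stopping.
      rewrite (J1_randomized rc' Pi_ge0 alpha01 (W := fun n e => - W' n e)) //.
      - by rewrite -EFinN opprK.
      - by case.
      - have [B0 W0B] := finite_bound (W' 0%N); have [B WB'] := finite_bound W.
        by exists (Num.max B0 B) => -[|n] e'; rewrite normrN le_max ?W0B ?WB' ?orbT.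
      - case=> [|n] e'; rewrite stop_gain_opp continuation_gain_opp !mulrN -opprD //.
        congr (- _); rewrite /W' /= [LHS]WE /stop_gain /continuation_gain.
        by ring.
    rewrite -lee_fin -[leRHS]JW' -JW; case: (eqm e) => _ ->.
    apply: ereal_inf_lbound; exists (randomized_time X eta r') => //.
    exact: randomized_time_stopping.
  have r0 : 0 <= (0 : R) <= 1 by rewrite lexx ler01.
  have r1 : 0 <= (1 : R) <= 1 by rewrite lexx ler01.
  move=> e; split.
  + by have := dev1 1 e r1; rewrite subrr mul0r addr0 mul1r.
  + by have := dev1 0 e r0; rewrite subr0 mul0r add0r mul1r.
  + by have := dev2 1 e r1; rewrite subrr mul0r addr0 mul1r.
  + by have := dev2 0 e r0; rewrite subr0 mul0r add0r mul1r.
- split => // x; split.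
  + apply/eqP; rewrite eq_le; apply/andP; split; last first.
      by apply: ereal_sup_ubound; exists (markov_time X xi p).
    rewrite JW; apply: ge_ereal_sup => _ [tau tauT <-].
    apply: (J1_le_supersolution rc) => // e; first by case: (shot e).
    by case: (shot e).
  + apply/eqP; rewrite eq_le; apply/andP; split; last first.
      by apply: ereal_inf_lbound; exists (markov_time X eta q).
    rewrite JW; apply: le_ereal_inf_tmp => _ [tau tauT <-].
    rewrite J1_swap // leeNr -EFinN.
    apply: (J1_le_supersolution rc' Pi_ge0 alpha01 p01 (W := fun e => - W e)) => // e.
      by rewrite stop_gain_opp lerN2; case: (shot e).
    by rewrite continuation_gain_opp lerN2; case: (shot e).
Qed.

End Equilibria.

(** * The two-state game *)

(** Solves the value recursion of a stationary pair one state at a time. *)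
Lemma affine_fixpoint (R : realType) (a k : R) : k < 1 ->
  exists v, v = a + k * v.
Proof.
move=> k1; exists (a / (1 - k)).
have k1' : 1 - k != 0 by rewrite subr_eq0 gt_eqF.
by field.
Qed.

Lemma discount_product_lt1 (R : realType) (p q c : R) :
  0 <= p <= 1 -> 0 <= q <= 1 -> 0 <= c < 1 -> (1 - p) * (1 - q) * c < 1.
Proof.
move=> /andP[p0 p1] /andP[q0 q1] /andP[c0 c1].
apply: le_lt_trans c1; rewrite -[leRHS]mul1r ler_wpM2r //.
by rewrite mulr_ile1 ?subr_ge0 // lerBlDr lerDl.
Qed.

(** At the absorbing state player 1 is paid between 4 and 5 by stopping, while
    player 2 pays between 3 and 4 by stopping, so both must stop. *)
Lemma absorbing_state_unique (R : realType) (p q v : R) :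
    p <= 1 -> q <= 1 -> q * 4 + (1 - q) * 5 <= v -> v <= p * 4 + (1 - p) * 3 ->
  [/\ p = 1, q = 1 & v = 4].
Proof. by move=> p1 q1 h1 h2; split; lra. Qed.

(** The stopping inequalities give q <= p, the waiting inequalities p <= q.
    Hence all four are equalities, v = 2 p, and p solves a quadratic equation
    whose only root in the unit interval is 1 / 2. *)
Lemma transient_state_unique (R : realType) (p q v : R) :
    0 <= p <= 1 -> 0 <= q <= 1 ->
    q * 2 <= v -> (1 - q) * (2 / 5 * (v + 4)) <= v ->
    v <= p * 2 -> v <= (1 - p) * (2 / 5 * (v + 4)) ->
  p = 1 / 2 /\ q = 1 / 2.
Proof.
move=> /andP[p0 p1] /andP[q0 q1] stop1 wait1 stop2 wait2.
have v4 : 0 < 2 / 5 * (v + 4) by lra.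
have pq : p = q.
  apply: le_anti; apply/andP; split; last by lra.
  by have := le_trans wait1 wait2; rewrite ler_pM2r // => ?; lra.
subst q; have vE : v = p * 2 by lra.
(* the equality v = (1 - p) (2 / 5) (v + 4) at v = 2 p, factored *)
have /eqP : (2 * p - 1) * (p + 4) = 0 by subst v; lra.
rewrite mulf_eq0 => /orP[] /eqP ?; last by lra.
by split; lra.
Qed.

Lemma two_states (Q : 'I_2 -> Prop) : Q ord0 -> Q ord_max -> forall e, Q e.
Proof.
move=> Q1 Q2 [[|[|//]] i].
  by rewrite (_ : Ordinal i = ord0) //; exact: val_inj.
by rewrite (_ : Ordinal i = ord_max) //; exact: val_inj.
Qed.

Theorem mainTheorem5 (R : realType) (d : measure_display)
    (Omega : measurableType d) (P : 'I_2 -> probability Omega R)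
    (X : nat -> Omega -> 'I_2) (xi1 xi2 : nat -> Omega -> R) :
  let Pi : 'M[R]_2 := \matrix_(i, j)
    on_states (on_states (1 / 2) (1 / 2))
              (on_states 0       1      ) i j in
  let alpha : R := 4 / 5 in
  let f : 'I_2 -> R := on_states 0 5 in
  let g : 'I_2 -> R := on_states 0 3 in
  let h : 'I_2 -> R := on_states 2 4 in
  let p1 : 'I_2 -> R := on_states (1 / 2) 1 in
  let p2 : 'I_2 -> R := on_states (1 / 2) 1 in
  randomized_chain Pi P X xi1 xi2 ->
  global_markovian_equilibrium P X xi1 xi2 alpha f g h p1 p2
  /\
  forall q1 q2 : 'I_2 -> R,
    global_markovian_equilibrium P X xi1 xi2 alpha f g h q1 q2 ->
    q1 = p1 /\ q2 = p2.
Proof.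
move=> Pi alpha f g h p1 p2 rc.
pose s1 : 'I_2 := ord0; pose s2 : 'I_2 := ord_max.
have alpha01 : 0 <= alpha < 1 by rewrite /alpha; apply/andP; split; lra.
have Pi_ge0 e e' : 0 <= Pi e e'.
  by move: e e'; do 2 apply: two_states; rewrite mxE /on_states /=; lra.
have cont1 (u q W : 'I_2 -> R) : continuation_gain Pi alpha u q W s1 =
    q s1 * u s1 + (1 - q s1) * (2 / 5 * (W s1 + W s2)).
  rewrite /continuation_gain big_ord_recl big_ord1 !mxE /on_states /= /alpha.
  rewrite (_ : lift _ _ = s2); last exact: val_inj.
  by field.
have cont2 (u q W : 'I_2 -> R) : continuation_gain Pi alpha u q W s2 =
    q s2 * u s2 + (1 - q s2) * (4 / 5 * W s2).
  rewrite /continuation_gain big_ord_recl big_ord1 !mxE /on_states /= /alpha.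
  rewrite (_ : lift _ _ = s2); last exact: val_inj.
  by field.
split.
  apply/(equilibriumP rc Pi_ge0 alpha01 (W := on_states 1 4)).
  - by apply: two_states; rewrite /p1 /on_states /=; lra.
  - by apply: two_states; rewrite /p2 /on_states /=; lra.
  - apply: two_states; rewrite ?cont1 ?cont2 /stop_gain /p1 /p2 /f /g /h
      /on_states /=; lra.
  - by apply: two_states; rewrite ?cont1 ?cont2 /stop_gain /p1 /p2 /f /g /h
      /on_states /=; split; lra.
move=> q1 q2 eqm; have [q101 q201 _] := eqm.
(* the absorbing state 2 decouples, and its value enters the recursion at 1 *)
have [v2 v2E] := affine_fixpoint (q1 s2 * stop_gain f h q2 s2
    + (1 - q1 s2) * (q2 s2 * 3))
  (discount_product_lt1 (q101 s2) (q201 s2) alpha01).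
have c01 : 0 <= (2 / 5 : R) < 1 by apply/andP; split; lra.
have [v1 v1E] := affine_fixpoint (q1 s1 * stop_gain f h q2 s1
    + (1 - q1 s1) * (1 - q2 s1) * (2 / 5) * v2)
  (discount_product_lt1 (q101 s1) (q201 s1) c01).
have WE e : on_states v1 v2 e = q1 e * stop_gain f h q2 e
    + (1 - q1 e) * continuation_gain Pi alpha g q2 (on_states v1 v2) e.
  move: e; apply: two_states; rewrite ?cont1 ?cont2 [in LHS]/on_states /=.
    by rewrite {1}v1E /g /on_states /=; ring.
  by rewrite {1}v2E /g /alpha /on_states /=; ring.
have shot := (equilibriumP rc Pi_ge0 alpha01 q101 q201 WE).1 eqm.
have [p21 q21 v24] : [/\ q1 s2 = 1, q2 s2 = 1 & v2 = 4].
  have [stop1 _ stop2 _] := shot s2.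
  case/andP: (q101 s2) (q201 s2) => _ ? /andP[_ ?].
  by apply: absorbing_state_unique.
have [p11 q11] : q1 s1 = 1 / 2 /\ q2 s1 = 1 / 2.
  have [] := shot s1; rewrite !cont1 /stop_gain /f /g /h /on_states /= v24.
  rewrite !mulr0 !addr0 !add0r; exact: transient_state_unique.
by split; apply/funext; apply: two_states.
Qed.
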